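(* Let $A_1,\dots,A_N$ be real symmetric positive definite $n\times n$ matrices and let $w_1,\dots,w_N$ be weights. Consider the convex optimization problem in the variables $X$ (a real symmetric positive definite $n\times n$ matrix) and $K_1,\dots,K_N\in\mathbb{R}^{n\times n}$: $$\min\ \sum_{i=1}^N w_i\left(\operatorname{Tr}(A_i)+\operatorname{Tr}(X)-2\operatorname{Tr}\left(\sqrt{A_i}\,K_i\right)\right)\quad\text{subject to}\quad \begin{bmatrix}X & K_i^\top\\ K_i & I\end{bmatrix}\succeq 0\ \text{ for all } i=1,\dots,N.$$ Then the optimum lies on the boundary of each of the $N$ constraints (that is, $K_i^\top K_i=X$ for every $i$), and hence the weighted Bures-Wasserstein barycenter of $A_1,\dots,A_N$ with weights $w_1,\dots,w_N$ can be calculated by solving this problem: the barycenter is the matrix $X$ obtained at the optimum.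
   Context: For a real symmetric positive definite matrix $X$, $\sqrt{X}$ denotes its unique symmetric positive definite square root. $O(n)$ is the group of real orthogonal $n\times n$ matrices, $\|\cdot\|_F$ is the Frobenius norm, $I$ is the $n\times n$ identity matrix, and $M\succeq 0$ means that the symmetric matrix $M$ is positive semidefinite. The Bures-Wasserstein distance between positive definite matrices $A,B$ is $$\rho(A,B)=\min_{U,V\in O(n)}\left\|\sqrt{A}\,U-\sqrt{B}\,V\right\|_F .$$ The weighted Bures-Wasserstein barycenter of $A_1,\dots,A_N$ with weights $w_1,\dots,w_N$ is the positive definite matrix $X$ minimizing $\sum_{i=1}^N w_i\,\rho^2(A_i,X)$. *)

(* Defs.v *)
From mathcomp Require Import all_boot all_order all_algebra.
From mathcomp Require Import all_classical all_reals.

Set Implicit Arguments.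
Unset Strict Implicit.
Unset Printing Implicit Defensive.

Import Order.TTheory GRing.Theory Num.Theory.
Local Open Scope classical_set_scope.
Local Open Scope ring_scope.

Definition quadform (R : realType) (n : nat) (M : 'M[R]_n) (v : 'cV[R]_n) : R :=
  (v^T *m M *m v) 0 0.

Definition posdefmx (R : realType) (n : nat) (M : 'M[R]_n) : Prop :=
  M^T = M /\ forall v : 'cV[R]_n, v != 0 -> 0 < quadform M v.

Definition possemidefmx (R : realType) (n : nat) (M : 'M[R]_n) : Prop :=
  M^T = M /\ forall v : 'cV[R]_n, 0 <= quadform M v.

(* For [A] positive definite the set below is a singleton, so [xget] returns
   the unique positive definite square root of [A]; the default value [0] is
   used only if [A] has no such root. *)
Definition sqrtmx (R : realType) (n : nat) (A : 'M[R]_n) : 'M[R]_n :=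
  xget 0 [set S : 'M[R]_n | posdefmx S /\ S *m S = A].

(* The norm [`|M|] that the analysis library puts on matrices is the maximum
   norm, hence a separate definition. *)
Definition frobnorm (R : realType) (m n : nat) (M : 'M[R]_(m, n)) : R :=
  Num.sqrt (\sum_(i < m) \sum_(j < n) M i j ^+ 2).

Definition orthogonal_group (R : realType) (n : nat) : set 'M[R]_n :=
  [set U | U^T *m U = 1%:M].

Arguments orthogonal_group : clear implicits.

(* The infimum is a minimum: a continuous function on the nonempty compact set
   O(n) x O(n). *)
Definition bures_wasserstein (R : realType) (n : nat) (A B : 'M[R]_n) : R :=
  inf [set frobnorm (sqrtmx A *m U - sqrtmx B *m V)
      | U in orthogonal_group R n & V in orthogonal_group R n].

Definition bary_cost (R : realType) (n N : nat) (w : 'I_N -> R)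
    (A : 'I_N -> 'M[R]_n) (X : 'M[R]_n) : R :=
  \sum_(i < N) w i * bures_wasserstein (A i) X ^+ 2.

Definition is_barycenter (R : realType) (n N : nat) (w : 'I_N -> R)
    (A : 'I_N -> 'M[R]_n) (X : 'M[R]_n) : Prop :=
  posdefmx X /\
  forall Y : 'M[R]_n, posdefmx Y -> bary_cost w A X <= bary_cost w A Y.

Definition sdp_cost (R : realType) (n N : nat) (w : 'I_N -> R)
    (A : 'I_N -> 'M[R]_n) (X : 'M[R]_n) (K : 'I_N -> 'M[R]_n) : R :=
  \sum_(i < N) w i * (\tr (A i) + \tr X - 2 * \tr (sqrtmx (A i) *m K i)).

Definition sdp_feasible (R : realType) (n N : nat)
    (X : 'M[R]_n) (K : 'I_N -> 'M[R]_n) : Prop :=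
  posdefmx X /\
  forall i : 'I_N, possemidefmx (block_mx X (K i)^T (K i) 1%:M).

Definition sdp_optimum (R : realType) (n N : nat) (w : 'I_N -> R)
    (A : 'I_N -> 'M[R]_n) (X : 'M[R]_n) (K : 'I_N -> 'M[R]_n) : Prop :=
  sdp_feasible X K /\
  forall (Y : 'M[R]_n) (L : 'I_N -> 'M[R]_n),
    sdp_feasible Y L -> sdp_cost w A X K <= sdp_cost w A Y L.

(* Main.v *)
Require Import Defs.
From mathcomp Require Import all_boot all_order all_algebra.
From mathcomp Require Import all_classical all_reals.
From mathcomp Require Import topology normedtype derive.
From mathcomp Require Import ring lra.
Import Order.TTheory GRing.Theory Num.Theory.
Import numFieldTopology.Exports.
Local Open Scope ring_scope.

(** Everything follows from one optimality certificate.  Write [S i] for the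
    square root of [A i] and [W] for the sum of the weights, and suppose that
    there are positive definite matrices [X] and [T i] such that
      [T i *m X *m T i = A i]   and   [\sum_i w i *: T i = W%:M].
    ([T i] is the optimal transport map from the centred Gaussian law of
    covariance [X] to the one of covariance [A i].)  For every feasible point
    [(Y, L)] of the semidefinite program, completing the square
    ([transport_gap]) gives
      [tr (T X) + tr (T Y) - 2 tr (S L)
         = tr (T (Y - L^T L)) + tr (T (L - S T^-1)^T (L - S T^-1)) >= 0]
    for each index.  In the weighted sum of these inequalities the terms
    [tr (T i *m Y)] add up to [W * \tr Y], so the cost of [(Y, L)] is at least a
    constant that does not depend on [(Y, L)].  Equality forces
    [L i = S i *m invmx (T i)], hence [(L i)^T *m L i = X], and [Y = X]: the
    program has exactly one optimum and all its constraints are tight there.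

    The same inequality, with [X] replaced by [Y], computes the
    Bures-Wasserstein distance ([bures_wassersteinE]): if [T Y T = A], then
    [rho^2 (A, Y) = tr A + tr Y - 2 tr (T Y)], and the value is attained.  So
    for fixed [Y] the barycenter cost is the cost of a feasible point
    [(Y, L)], and the two problems have the same value and the same minimiser.

    The matrices [X] and [T i] come from the dual program
    ([transport_maps_exist]): minimise [\sum_i w i * \tr (invmx (T i) *m A i)]
    over positive definite [T i] with [\sum_i w i *: T i = W%:M].  The
    constraint bounds the [T i] and the objective keeps them away from singular matrices,
    so a minimum is attained in the open set of positive definite tuples.
    Stationarity says that [invmx (T i) *m A i *m invmx (T i)] does not
    depend on [i]; its common value is [X].

    Square roots are obtained from the same result, applied to the two
    matrices [A] and [1] with unit weights: then [T 0] and [T 1] commute and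
    [T 0 *m invmx (T 1)] squares to [A] ([posdef_sqrt_exists]). *)

Section BuresWassersteinBarycenter.
Context {R : realType}.
Set Implicit Arguments.
Unset Strict Implicit.
Unset Printing Implicit Defensive.

Local Notation coord_space K := (prod_topology (fun _ : K => R^o)).

(** * Quadratic forms and definite matrices *)

Lemma quadformD n (M P : 'M[R]_n) v :
  quadform (M + P) v = quadform M v + quadform P v.
Proof. by rewrite /quadform mulmxDr mulmxDl mxE. Qed.

Lemma quadformZ n a (M : 'M[R]_n) v : quadform (a *: M) v = a * quadform M v.
Proof. by rewrite /quadform -scalemxAr -scalemxAl mxE. Qed.

Lemma quadformN n (M : 'M[R]_n) v : quadform (- M) v = - quadform M v.
Proof. by rewrite -scaleN1r quadformZ mulN1r. Qed.

Lemma quadform_congr m n (M : 'M[R]_m) (B : 'M[R]_(m, n)) v :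
  quadform (B^T *m M *m B) v = quadform M (B *m v).
Proof. by rewrite /quadform trmx_mul !mulmxA. Qed.

Lemma quadform_scale n (M : 'M[R]_n) a v :
  quadform M (a *: v) = a ^+ 2 * quadform M v.
Proof.
by rewrite /quadform -scalemxAr [(_ *: v)^T]linearZ /= -!scalemxAl !mxE expr2 mulrA.
Qed.

Lemma quadform_add n (M : 'M[R]_n) u v : M^T = M ->
  quadform M (u + v) =
    quadform M u + 2 * (u^T *m M *m v) 0 0 + quadform M v.
Proof.
move=> sM; have add00 (P Q : 'M[R]_1) : (P + Q) 0 0 = P 0 0 + Q 0 0.
  by rewrite mxE.
rewrite /quadform [(u + v)^T]linearD /= !mulmxDl !mulmxDr !add00.
have -> : (v^T *m M *m u) 0 0 = (u^T *m M *m v) 0 0.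
  by rewrite -[in RHS](trmxK (u^T *m M *m v)) [RHS]mxE !trmx_mul trmxK sM mulmxA.
by ring.
Qed.

Lemma quadform1 n (v : 'cV[R]_n) : quadform 1%:M v = \sum_i v i 0 ^+ 2.
Proof.
rewrite /quadform mulmx1 mxE; apply: eq_bigr => i _.
by rewrite mxE expr2.
Qed.

Lemma quadform_delta n (M : 'M[R]_n) i : quadform M (delta_mx i 0) = M i i.
Proof.
rewrite /quadform trmx_delta -rowE mxE (bigD1 i) //= big1 => [|j ji].
  by rewrite !mxE !eqxx mulr1 addr0.
by rewrite !mxE (negbTE ji) mulr0.
Qed.

Lemma posdef_possemidef n (M : 'M[R]_n) : posdefmx M -> possemidefmx M.
Proof.
move=> [sM pM]; split=> // v; have [->|/pM/ltW//] := eqVneq v 0.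
by rewrite /quadform mulmx0 mxE.
Qed.

Lemma posdefD n (M P : 'M[R]_n) :
  posdefmx M -> possemidefmx P -> posdefmx (M + P).
Proof.
move=> [sM pM] [sP pP]; split; first by rewrite linearD /= sM sP.
by move=> v v0; rewrite quadformD ltr_wpDr// pM.
Qed.

Lemma possemidefZ n a (M : 'M[R]_n) :
  0 <= a -> possemidefmx M -> possemidefmx (a *: M).
Proof.
move=> a0 [sM pM]; split; first by rewrite linearZ /= sM.
by move=> v; rewrite quadformZ mulr_ge0.
Qed.

Lemma posdefZ n a (M : 'M[R]_n) : 0 < a -> posdefmx M -> posdefmx (a *: M).
Proof.
move=> a0 [sM pM]; split; first by rewrite linearZ /= sM.
by move=> v v0; rewrite quadformZ mulr_gt0// pM.
Qed.

Lemma possemidef_congr m n (M : 'M[R]_m) (B : 'M[R]_(m, n)) :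
  possemidefmx M -> possemidefmx (B^T *m M *m B).
Proof.
move=> [sM pM]; split; first by rewrite !trmx_mul sM trmxK mulmxA.
by move=> v; rewrite quadform_congr.
Qed.

Lemma posdef1 n : posdefmx (1%:M : 'M[R]_n).
Proof.
split=> [|v v0]; first by rewrite trmx1.
have s0 : 0 <= \sum_i v i 0 ^+ 2 by apply: sumr_ge0 => i _; exact: sqr_ge0.
rewrite quadform1 lt_neqAle s0 andbT; apply: contra v0.
rewrite eq_sym psumr_eq0; last by move=> i _; exact: sqr_ge0.
move=> /allP v0; apply/eqP/matrixP => i j; rewrite ord1 mxE.
by have := v0 i; rewrite mem_index_enum sqrf_eq0 => /(_ isT)/eqP.
Qed.

Lemma possemidef_gram m n (B : 'M[R]_(m, n)) : possemidefmx (B^T *m B).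
Proof.
by rewrite -[B^T]mulmx1; apply/possemidef_congr/posdef_possemidef/posdef1.
Qed.

Lemma possemidef_diag n (M : 'M[R]_n) i : possemidefmx M -> 0 <= M i i.
Proof. by move=> [_ pM]; rewrite -quadform_delta. Qed.

Lemma possemidef_tr_ge0 n (M : 'M[R]_n) : possemidefmx M -> 0 <= \tr M.
Proof. by move=> pM; apply: sumr_ge0 => i _; exact: possemidef_diag. Qed.

(** Testing the form on [e_i + e_j] and [e_i - e_j] gives
    [2 |M i j| <= M i i + M j j].  This bound makes trace-bounded sets of
    positive semidefinite matrices bounded entry by entry. *)
Lemma possemidef_entry_le_tr n (M : 'M[R]_n) i j :
  possemidefmx M -> `|M i j| <= \tr M.
Proof.
move=> pM; have dM k := possemidef_diag k pM.
have trk k : M k k <= \tr M.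
  by rewrite /mxtrace (bigD1 k) //= lerDl sumr_ge0.
have bil a : quadform M (delta_mx i 0 + a *: delta_mx j 0) =
    M i i + 2 * (a * M i j) + a ^+ 2 * M j j.
  rewrite quadform_add ?(proj1 pM)// quadform_scale !quadform_delta.
  congr (_ + 2 * _ + _); rewrite -scalemxAr mxE; congr (_ * _).
  by rewrite trmx_delta -rowE -colE !mxE.
have := (proj2 pM) (delta_mx i 0 + 1 *: delta_mx j 0).
have := (proj2 pM) (delta_mx i 0 + (-1) *: delta_mx j 0).
rewrite !bil ler_norml => *; have := trk i; have := trk j.
by move=> *; apply/andP; split; lra.
Qed.

Lemma possemidef_tr_eq0 n (M : 'M[R]_n) : possemidefmx M -> \tr M = 0 -> M = 0.
Proof.
move=> pM tM; apply/matrixP => i j; rewrite mxE; apply/eqP.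
by rewrite -normr_le0 -tM possemidef_entry_le_tr.
Qed.

Lemma posdef_unitmx n (M : 'M[R]_n) : posdefmx M -> M \in unitmx.
Proof.
move=> [sM pM]; rewrite unitmxE unitfE; apply/negP => /det0P[v v0 vM].
have := pM v^T; rewrite /quadform trmxK vM mul0mx mxE ltxx.
by rewrite trmx_eq0 v0 => /(_ isT).
Qed.

Lemma posdef_congr n (M B : 'M[R]_n) :
  B \in unitmx -> posdefmx M -> posdefmx (B^T *m M *m B).
Proof.
move=> uB [sM pM]; split; first by rewrite !trmx_mul sM trmxK mulmxA.
move=> v v0; rewrite quadform_congr pM//; apply: contraNneq v0 => Bv.
by rewrite -(mulKmx uB v) Bv mulmx0.
Qed.

Lemma posdef_inv n (M : 'M[R]_n) : posdefmx M -> posdefmx (invmx M).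
Proof.
move=> pM; have uM := posdef_unitmx pM.
have := posdef_congr (_ : invmx M \in unitmx) pM; rewrite unitmx_inv.
by move=> /(_ uM); rewrite trmx_inv (proj1 pM) mulVmx// mul1mx.
Qed.

(** With [u = M v], the value of the form at [u + t v] is an affine function
    of [t] with slope [2 |u|^2]; it is nonnegative for all [t], so [u = 0]. *)
Lemma possemidef_ker n (M : 'M[R]_n) v :
  possemidefmx M -> quadform M v = 0 -> M *m v = 0.
Proof.
move=> [sM pM] Mv; set u := M *m v.
have key t : 0 <= quadform M u + 2 * t * quadform 1%:M u.
  have := pM (u + t *: v); rewrite quadform_add// quadform_scale Mv.
  rewrite -scalemxAr mxE mulr0 addr0 mulrA.
  by rewrite -mulmxA -/u /quadform mulmx1.
apply/eqP/negP => /negP u0; have := (proj2 (posdef1 n)) u u0.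
set q := quadform 1%:M u in key *; set p := quadform M u in key * => q0.
have := key (- (p + 1) / (2 * q)).
have -> : 2 * (- (p + 1) / (2 * q)) * q = - (p + 1).
  by field; rewrite gt_eqF.
by lra.
Qed.

(** Induction on the size: eliminating the first variable leaves the Schur
    complement of the corner entry, which is again positive definite. *)
Lemma posdef_cholesky n (A : 'M[R]_n) :
  posdefmx A -> exists B : 'M[R]_n, A = B *m B^T.
Proof.
elim: n A => [|n IHn] A; first by exists 0; apply/matrixP => -[].
rewrite -(@submxK R 1 n 1 n A).
set a := ulsubmx _; set b := ursubmx _; set c := dlsubmx _; set D := drsubmx _.
move=> [+ pA]; rewrite (@tr_block_mx R 1 n 1 n) 
  => /(@eq_block_mx R 1 n 1 n)[_ cb _ sD].
have {}pA (v : 'cV[R]_(1 + n)) (v0 : v != 0) :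
    0 < quadform (block_mx a b c D) v.
  exact: pA.
pose s := a 0 0; have as_ : a = s%:M by rewrite [LHS]mx11_scalar.
have s0 : 0 < s.
  have := pA (col_mx (1%:M : 'cV_1) 0).
  rewrite col_mx_eq0 negb_and; have -> : (1%:M : 'cV[R]_1) != 0.
    by apply/negP => /eqP/matrixP/(_ 0 0); rewrite !mxE; apply/eqP/oner_neq0.
  move=> /(_ isT); rewrite /quadform tr_col_mx mul_row_block mul_row_col.
  by rewrite !trmx0 !mul0mx !mulmx0 !addr0 trmx1 mul1mx mulmx1.
have [|B' DB'] := IHn (D - s^-1 *: (b^T *m b)).
  split; first by rewrite linearB linearZ /= sD trmx_mul trmxK.
  move=> v v0.
  have := pA (col_mx (- s^-1 *: (b *m v)) v).
  have -> : col_mx (- s^-1 *: (b *m v)) v != 0.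
    by apply: contra v0; rewrite col_mx_eq0 => /andP[].
  move=> /(_ isT).
  rewrite {1}/quadform tr_col_mx mul_row_block mul_row_col.
  rewrite [(_ *: _)^T]linearZ /= trmx_mul.
  rewrite -cb !trmxK as_ mul_mx_scalar scalerA mulrN divff ?gt_eqF//.
  rewrite scaleN1r addNr mul0mx add0r.
  rewrite quadformD quadformN quadformZ /quadform mulmxDl mxE -!scalemxAl mxE.
  by rewrite !mulmxA addrC mulNr.
exists (block_mx (Num.sqrt s)%:M 0 ((Num.sqrt s)^-1 *: b^T) B').
rewrite (@tr_block_mx R 1 n 1 n) (@mulmx_block R 1 n 1 n 1 n).
have ss : Num.sqrt s * Num.sqrt s = s by rewrite -expr2 sqr_sqrtr// ltW.
have sn0 : Num.sqrt s != 0 by rewrite gt_eqF// sqrtr_gt0.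
rewrite tr_scalar_mx !trmx0 !mul0mx mulmx0 !addr0.
rewrite -scalar_mxM ss -as_ [(_ *: _)^T]linearZ /= trmxK.
rewrite mul_scalar_mx mul_mx_scalar !scalerA divff// !scale1r.
rewrite -scalemxAl -scalemxAr scalerA -invfM ss -DB' addrC subrK.
by rewrite -cb trmxK.
Qed.

Lemma posdef_tr_mul_ge0 n (T G : 'M[R]_n) :
  posdefmx T -> possemidefmx G -> 0 <= \tr (T *m G).
Proof.
move=> /posdef_cholesky[B ->] pG.
rewrite -mulmxA mxtrace_mulC -mulmxA.
by apply: possemidef_tr_ge0; rewrite mulmxA; exact: possemidef_congr.
Qed.

Lemma posdef_tr_mul_eq0 n (T G : 'M[R]_n) :
  posdefmx T -> possemidefmx G -> \tr (T *m G) = 0 -> G = 0.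
Proof.
move=> pT pG; have uT := posdef_unitmx pT; have [B TB] := posdef_cholesky pT.
have uB : B \in unitmx by move: uT; rewrite TB unitmx_mul => /andP[].
rewrite TB -mulmxA mxtrace_mulC => /(possemidef_tr_eq0 (possemidef_congr B pG)).
move=> /(congr1 (fun M => invmx B^T *m M *m invmx B)).
by rewrite -!mulmxA mulKmx ?unitmx_tr// mulmxV// mulmx1 mul0mx mulmx0.
Qed.

(** * Minima over closed bounded sets of coordinates *)

Lemma bounded_closed_min (K : finType) (C : set (coord_space K))
    (f : coord_space K -> R) (b : R) :
  (C !=set0)%classic -> closed C -> continuous f ->
  (forall x, C x -> forall k, `|x k| <= b) ->
  exists2 c, C c & forall x, C x -> f c <= f x.
Proof.
move=> C0 clC cf bC.
have cC : compact C.
  apply: (@subclosed_compact _ C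
    [set x : coord_space K | forall k, `[- b, b]%classic (x k)]%classic) => //.
    exact: (@tychonoff K (fun=> R^o) (fun=> `[- b, b]%classic)
      (fun=> @segment_compact R (- b) b)).
  by move=> x Cx k; rewrite /= in_itv /= -ler_norml bC.
have [|c] := compact_EVT_min C0 cC (f := f).
  exact: continuous_subspaceT.
by rewrite inE => Cc minc; exists c => // x Cx; apply: minc; rewrite inE.
Qed.

Lemma continuous_coord (K : finType) k :
  continuous (fun x : coord_space K => x k : R).
Proof. exact: (@proj_continuous K (fun=> R^o) k). Qed.

Lemma continuous_fsum (X : topologicalType) (I : Type) (r : seq I)
    (F : I -> X -> R^o) :
  (forall i, continuous (F i)) -> continuous (fun x => \sum_(i <- r) F i x).
Proof.
move=> cF x; apply: (@cvg_big _ _ +%R) => [|i _]; last exact: cF.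
exact: add_continuous.
Qed.

Lemma continuous_wsum (X : topologicalType) (I : Type) (r : seq I) (a : I -> R)
    (F : I -> X -> R^o) : (forall i, continuous (F i)) ->
  continuous (fun x => \sum_(i <- r) a i * F i x : R^o).
Proof.
move=> cF; apply: continuous_fsum => i x.
by apply: cvgM; [exact: cvg_cst | exact: cF].
Qed.

Lemma closed_forall (X : topologicalType) (I : Type) (P : I -> X -> Prop) :
  (forall i, closed [set x | P i x]%classic) ->
  closed [set x | forall i, P i x]%classic.
Proof.
move=> clP.
have -> : ([set x | forall i, P i x] = \bigcap_i [set x | P i x])%classic.
  by apply/seteqP; split=> x /= Px i; [move=> _; exact: Px | exact: (Px i)].
by apply: closed_bigI => i _; exact: clP.
Qed.

Lemma closed_nonneg (X : topologicalType) (f : X -> R^o) :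
  continuous f -> closed [set x | 0 <= f x]%classic.
Proof.
by move=> cf; apply: (@preimage_closed _ _ f [set y | 0 <= y]%classic) => //;
  exact: closed_ge.
Qed.

Lemma closed_sublevel (X : topologicalType) (f : X -> R^o) (a : R) :
  continuous f -> closed [set x | f x <= a]%classic.
Proof.
by move=> cf; apply: (@preimage_closed _ _ f [set y | y <= a]%classic) => //;
  exact: closed_le.
Qed.

Lemma closed_equation (X : topologicalType) (f : X -> R^o) (a : R) :
  continuous f -> closed [set x | f x = a]%classic.
Proof.
by move=> cf; apply: (@preimage_closed _ _ f [set y | y = a]%classic) => //;
  exact: closed_eq.
Qed.

(** * The dual program attains its minimum *)

Lemma continuous_quadform (X : topologicalType) n (M : X -> 'M[R]_n) v :
  (forall k l, continuous (fun x => M x k l : R^o)) ->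
  continuous (fun x => quadform (M x) v : R^o).
Proof.
move=> cM.
have -> : (fun x => quadform (M x) v : R^o) =
    fun x => \sum_l v l 0 * \sum_k v k 0 * M x k l.
  apply/funext => x; rewrite /quadform mxE; apply: eq_bigr => l _.
  by rewrite mxE mulrC; congr (_ * _); apply: eq_bigr => k _; rewrite mxE.
apply: continuous_wsum => l; apply: continuous_wsum => k; exact: cM.
Qed.

Lemma closed_possemidef (X : topologicalType) n (M : X -> 'M[R]_n) :
  (forall k l, continuous (fun x => M x k l : R^o)) ->
  closed [set x | possemidefmx (M x)]%classic.
Proof.
move=> cM.
have -> : ([set x | possemidefmx (M x)] =
    [set x | forall k l, M x k l - M x l k = 0] `&`
    [set x | forall v, (0 <= quadform (M x) v)%R])%classic.
  apply/seteqP; split=> x /= [sM pM]; split=> //.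
    by move=> k l; rewrite -{2}sM mxE subrr.
  by apply/matrixP => k l; rewrite mxE; apply/eqP; rewrite -subr_eq0 sM.
apply: closedI; apply: closed_forall => k.
  apply: closed_forall => l; apply: closed_equation.
  by move=> x; apply: cvgB; exact: cM.
exact/closed_nonneg/continuous_quadform.
Qed.

(** The dual program in conic form.  For [T i] positive definite, the block
    constraint says that [P i] dominates [(B i)^T *m invmx (T i) *m B i], so
    that [\tr (P i)] stands for [\tr (invmx (T i) *m A i)] with
    [A i = B i *m (B i)^T].  All constraints are closed in [(T, P)], unlike
    positive definiteness of [T i]. *)
Definition dual_feasible n N (w : 'I_N -> R) (B T P : 'I_N -> 'M[R]_n) :=
  (forall i, possemidefmx (block_mx (T i) (B i) (B i)^T (P i))) /\
  \sum_i w i *: T i = (\sum_i w i)%:M.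

(** Below a given cost the feasible set is compact: the linear constraint
    bounds [\tr (T i)], the cost bounds [\tr (P i)], and the trace bounds every
    entry of a positive semidefinite matrix. *)
Lemma dual_attained n N (w : 'I_N -> R) (B : 'I_N -> 'M[R]_n) :
  (forall i, 0 < w i) ->
  exists T P, dual_feasible w B T P /\
    forall T' P', dual_feasible w B T' P' ->
      \sum_i w i * \tr (P i) <= \sum_i w i * \tr (P' i).
Proof.
move=> w0.
pose K := ('I_N * 'I_(n + n) * 'I_(n + n))%type.
pose Z (x : coord_space K) i : 'M[R]_(n + n) := \matrix_(k, l) x (i, k, l).
pose T x i := ulsubmx (Z x i); pose P x i := drsubmx (Z x i).
pose cost (P : 'I_N -> 'M[R]_n) := \sum_i w i * \tr (P i).
(* The cost of the feasible point [T i = 1]; larger costs are irrelevant to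
   the minimum. *)
pose c := cost (fun i => (B i)^T *m B i).
pose C := ([set x | forall i, possemidefmx (Z x i)] `&`
  [set x | forall i k l, ursubmx (Z x i) k l = B i k l] `&`
  [set x | forall k l, (\sum_i w i *: T x i) k l = ((\sum_i w i)%:M : 'M_n) k l]
  `&` [set x | (cost (P x) <= c)%R])%classic.
have cZ i k l : continuous (fun x => Z x i k l : R^o).
  have -> : (fun x => Z x i k l : R^o) = fun x => x (i, k, l).
    by apply/funext => x; rewrite mxE.
  exact: continuous_coord.
have ccost : continuous (fun x => cost (P x) : R^o).
  rewrite (_ : (fun x => _) = fun x =>
      \sum_i w i * \sum_k Z x i (rshift n k) (rshift n k)); last first.
    apply/funext => x; apply: eq_bigr => i _; congr (_ * _).
    by apply: eq_bigr => k _; rewrite mxE mxE.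
  by apply: continuous_wsum => i; apply: continuous_fsum => k; exact: cZ.
have clC : closed C.
  apply: closedI; [apply: closedI; [apply: closedI|]|].
  - by apply: closed_forall => i; exact: closed_possemidef.
  - apply: closed_forall => i; apply: closed_forall => k.
    apply: closed_forall => l; apply: closed_equation.
    rewrite (_ : (fun x => _) = fun x => Z x i (lshift n k) (rshift n l)) //.
    by apply/funext => y; rewrite mxE mxE.
  - apply: closed_forall => k; apply: closed_forall => l.
    apply: closed_equation.
    rewrite (_ : (fun x => _) =
      fun x => \sum_i w i * Z x i (lshift n k) (lshift n l)).
      by apply: continuous_wsum => i; exact: cZ.
    apply/funext => y; rewrite summxE; apply: eq_bigr => i _.
    by rewrite mxE mxE mxE.
  - exact: closed_sublevel.
have unpack T' P' : dual_feasible w B T' P' -> cost P' <= c ->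
    exists2 x, C x & P x = P'.
  move=> [psd sumT] le_c.
  pose x : coord_space K := fun k =>
    block_mx (T' k.1.1) (B k.1.1) (B k.1.1)^T (P' k.1.1) k.1.2 k.2.
  have Zx i : Z x i = block_mx (T' i) (B i) (B i)^T (P' i).
    by apply/matrixP => k l; rewrite mxE.
  have Px : P x = P' by apply/funext => i; rewrite /P Zx block_mxKdr.
  exists x => //; split; [split; [split|]|] => /=.
  - by move=> i; rewrite Zx.
  - by move=> i k l; rewrite Zx block_mxKur.
  - move=> k l; rewrite -sumT; congr (fun_of_matrix _ k l).
    by apply: eq_bigr => i _; rewrite /T Zx block_mxKul.
  - by rewrite Px.
have pack x : C x -> dual_feasible w B (T x) (P x) /\ cost (P x) <= c.
  move=> [[[psd Bx] sumT]]; move=> /= le_c; split=> //; split.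
    move=> i; have BZ : B i = ursubmx (Z x i) by apply/matrixP => k l.
    by rewrite BZ trmx_ursub (proj1 (psd i)) submxK.
  by apply/matrixP => k l; exact: sumT.
have start : dual_feasible w B (fun=> 1%:M) (fun i => (B i)^T *m B i).
  split=> [i|]; last by rewrite -scaler_suml scalemx1.
  have := possemidef_gram (row_mx 1%:M (B i)).
  by rewrite tr_row_mx mul_col_row trmx1 !mul1mx mulmx1.
have [x0 Cx0 _] := unpack _ _ start (lexx _).
pose W := \sum_i w i.
pose b := \sum_i (W * n%:R + c) / w i.
have bC x : C x -> forall k, `|x k| <= b.
  move=> /[dup] Cx /pack [[psd sumT] le_c] [[i k] l].
  have psdZ j : possemidefmx (Z x j) by case: Cx => -[[+ _] _] _; apply.
  have psdT j : possemidefmx (T x j).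
    have [sZ pZ] := psdZ j; split; first by rewrite trmx_ulsub sZ.
    move=> v; have := pZ (col_mx v 0).
    rewrite -[Z x j]submxK /quadform tr_col_mx mul_row_block mul_row_col.
    by rewrite !trmx0 !mul0mx !addr0 mulmx0 addr0.
  have psdP j : possemidefmx (P x j).
    have [sZ pZ] := psdZ j; split; first by rewrite trmx_drsub sZ.
    move=> v; have := pZ (col_mx 0 v).
    rewrite -[Z x j]submxK /quadform tr_col_mx mul_row_block mul_row_col.
    by rewrite !trmx0 !mul0mx !add0r mulmx0 add0r.
  have trT j : w j * \tr (T x j) <= W * n%:R.
    have -> : W * n%:R = \sum_i w i * \tr (T x i).
      rewrite mulr_natr -mxtrace_scalar -/W -sumT raddf_sum /=.
      by apply: eq_bigr => m _; rewrite mxtraceZ.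
    rewrite (bigD1 j) //= lerDl sumr_ge0// => m _.
    by apply: mulr_ge0; [exact/ltW | exact: possemidef_tr_ge0].
  have trP j : w j * \tr (P x j) <= c.
    apply: le_trans le_c; rewrite /cost (bigD1 j) //= lerDl sumr_ge0// => m _.
    by apply: mulr_ge0; [exact/ltW | exact: possemidef_tr_ge0].
  have bj j : 0 <= \tr (Z x j) <= (W * n%:R + c) / w j.
    rewrite possemidef_tr_ge0//= ler_pdivlMr// mulrC.
    rewrite -[Z x j]submxK mxtrace_block mulrDr lerD//.
  have -> : x (i, k, l) = Z x i k l by rewrite mxE.
  apply: le_trans (possemidef_entry_le_tr _ _ (psdZ i)) _.
  have /andP[_ /le_trans] := bj i; apply.
  rewrite /b (bigD1 i) //= lerDl sumr_ge0// => j _.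
  by have /andP[/le_trans] := bj j; apply.
have [x Cx minx] := bounded_closed_min (ex_intro _ _ Cx0) clC ccost bC.
have [fx le_c] := pack x Cx.
exists (T x), (P x); split=> // T' P' f'.
have [/(unpack _ _ f')[y Cy <-]|/ltW] := lerP (cost P') c; first exact: minx.
exact: le_trans.
Qed.

(** * Stationarity of the dual minimum *)

(** The block matrix is [N^T T N] for [N = (1, T^-1 B)]. *)
Lemma schur_possemidef n (T B : 'M[R]_n) : posdefmx T ->
  possemidefmx (block_mx T B B^T (B^T *m invmx T *m B)).
Proof.
move=> pT; have uT := posdef_unitmx pT.
have := possemidef_congr (row_mx 1%:M (invmx T *m B)) (posdef_possemidef pT).
rewrite tr_row_mx mul_col_mx mul_col_row trmx1 !mul1mx !mulmx1.
rewrite trmx_mul trmx_inv (proj1 pT) mulKVmx//.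
by rewrite (mulmxKV uT) mulmxA.
Qed.

(** A null vector [v] of [T] gives a null vector [(v, 0)] of the whole block
    matrix, whose second block row then reads [B^T v = 0].  So an invertible
    off-diagonal block keeps dual feasible points away from singular [T]. *)
Lemma schur_posdef n (T B P : 'M[R]_n) : B \in unitmx ->
  possemidefmx (block_mx T B B^T P) -> posdefmx T.
Proof.
move=> uB pZ.
have qZ v : quadform (block_mx T B B^T P) (col_mx v 0) = quadform T v.
  rewrite /quadform tr_col_mx mul_row_block mul_row_col.
  by rewrite !trmx0 !mul0mx !addr0 mulmx0 addr0.
have sT : T^T = T.
  by move: (proj1 pZ); rewrite tr_block_mx => /eq_block_mx[].
split=> // v v0; rewrite lt_neqAle -qZ (proj2 pZ) andbT eq_sym.
apply: contraNneq v0 => /(possemidef_ker pZ).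
rewrite mul_block_col !mulmx0 !addr0 => /eqP.
rewrite col_mx_eq0 => /andP[_ /eqP Bv].
by rewrite -(mulKmx (_ : B^T \in unitmx) v) ?unitmx_tr// Bv mulmx0.
Qed.

(** The congruence by [N = (- T^-1 B, 1)] turns the block matrix into its Schur
    complement. *)
Lemma schur_tr_le n (T B P : 'M[R]_n) : posdefmx T ->
  possemidefmx (block_mx T B B^T P) -> \tr (B^T *m invmx T *m B) <= \tr P.
Proof.
move=> pT pZ; have uT := posdef_unitmx pT.
have := possemidef_congr (col_mx (- (invmx T *m B)) 1%:M) pZ.
rewrite tr_col_mx mul_row_block mul_row_col trmx1 !mul1mx !mulmx1.
rewrite [(- _)^T]linearN /= trmx_mul trmx_inv (proj1 pT) !mulNmx.
rewrite (mulmxKV uT) addNr mul0mx add0r => /possemidef_tr_ge0.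
by rewrite mxtraceD addrC [\tr (- _)]raddfN subr_ge0.
Qed.

(** The Sherman-Morrison formula.  When [s] is negative it also gives
    positivity: the right-hand side is then visibly positive definite, and the
    perturbed matrix is its inverse. *)
Lemma posdef_rank_one n (T : 'M[R]_n) (x : 'cV_n) s :
  posdefmx T -> 0 < 1 + s * quadform (invmx T) x ->
  posdefmx (T + s *: (x *m x^T)) /\
  invmx (T + s *: (x *m x^T)) = invmx T -
    (s / (1 + s * quadform (invmx T) x)) *:
      ((invmx T *m x) *m (invmx T *m x)^T).
Proof.
move=> pT; set a := quadform _ _ => pos; have uT := posdef_unitmx pT.
set y := invmx T *m x; set c := s / _; set J := invmx T - _.
have Ty : T *m y = x by rewrite mulKVmx.
have yT : x^T *m invmx T = y^T by rewrite trmx_mul trmx_inv (proj1 pT).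
have xy : x^T *m y = a%:M by rewrite [LHS]mx11_scalar /y mulmxA.
have MJ : (T + s *: (x *m x^T)) *m J = 1%:M.
  rewrite mulmxBr !mulmxDl mulmxV// -!scalemxAl -!scalemxAr.
  rewrite -[x *m x^T *m _]mulmxA yT.
  rewrite mulmxA Ty -mulmxA [x^T *m _]mulmxA xy mul_scalar_mx -scalemxAr.
  rewrite -addrA !scalerA -scalerDl -scalerBl.
  have -> : s - (c + s * (c * a)) = 0 by rewrite /c; field; rewrite gt_eqF.
  by rewrite scale0r addr0.
have uM : T + s *: (x *m x^T) \in unitmx by have [] := mulmx1_unit MJ.
have MV : invmx (T + s *: (x *m x^T)) = J.
  by rewrite -[LHS]mulmx1 -MJ mulKmx.
split=> //; have gram (z : 'cV[R]_n) : possemidefmx (z *m z^T).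
  by have := possemidef_gram z^T; rewrite trmxK.
have [s0|s0] := lerP 0 s; first by apply: posdefD => //; exact: possemidefZ.
rewrite -[_ + _]invmxK MV; apply: posdef_inv; rewrite /J -scaleNr.
apply: posdefD; first exact: posdef_inv.
by apply: possemidefZ => //; rewrite /c -mulNr divr_ge0 ?ltW// oppr_gt0.
Qed.

Lemma quadform_eq0 n (M : 'M[R]_n) :
  M^T = M -> (forall v, quadform M v = 0) -> M = 0.
Proof.
move=> sM M0; apply: possemidef_tr_eq0; first by split=> // v; rewrite M0.
by apply: big1 => i _; rewrite -quadform_delta.
Qed.

(** The dual minimum is perturbed along [T i + (t / w i) x x^T],
    [T j - (t / w j) x x^T], which preserves the linear constraint.  By the
    Sherman-Morrison formula the objective changes by
      [- t p_i / (1 + t a_i / w i) + t p_j / (1 - t a_j / w j)],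
    where [p_k] and [a_k] are the values at [x] of the forms
    [T_k^-1 A_k T_k^-1] and [T_k^-1].  Minimality gives [p_i <= p_j] as [t]
    tends to [0]; by symmetry all the forms [T_k^-1 A_k T_k^-1] coincide. *)
Lemma transport_maps_exist n N (w : 'I_N -> R) (A : 'I_N -> 'M[R]_n) :
  (0 < N)%N -> (forall i, 0 < w i) -> (forall i, posdefmx (A i)) ->
  exists (X : 'M[R]_n) (T : 'I_N -> 'M[R]_n),
    [/\ posdefmx X, forall i, posdefmx (T i),
        \sum_i w i *: T i = (\sum_i w i)%:M &
        forall i, T i *m X *m T i = A i].
Proof.
move=> N0 w0 pA; have [B AB] := choice (fun i => posdef_cholesky (pA i)).
have uB i : B i \in unitmx.
  by have := posdef_unitmx (pA i); rewrite AB unitmx_mul => /andP[].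
have [T [P [[psd sumT] minT]]] := dual_attained B w0.
have pT i : posdefmx (T i) by exact: schur_posdef (psd i).
pose X i := invmx (T i) *m A i *m invmx (T i).
have sTV i : (invmx (T i))^T = invmx (T i) by rewrite trmx_inv (proj1 (pT i)).
have pX i : posdefmx (X i).
  have := posdef_congr (_ : invmx (T i) \in unitmx) (pA i).
  by rewrite sTV; apply; rewrite unitmx_inv posdef_unitmx.
have leX i j x : i != j -> quadform (X i) x <= quadform (X j) x.
  move=> ij; rewrite leNgt; apply/negP => lt_p.
  pose p k := quadform (X k) x; pose a k := quadform (invmx (T k)) x.
  have p0 k : 0 <= p k by apply: (proj2 (posdef_possemidef (pX k))).
  have a0 k : 0 <= a k.
    by apply: (proj2 (posdef_possemidef (posdef_inv (pT k)))).
  pose alpha := a i / w i; pose beta := a j / w j.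
  have alpha0 : 0 <= alpha by rewrite divr_ge0// ltW.
  have beta0 : 0 <= beta by rewrite divr_ge0// ltW.
  pose D := p i - p j; have D0 : 0 < D by rewrite subr_gt0.
  pose E := p j * alpha + p i * beta + D * beta.
  have E0 : 0 <= E by rewrite !addr_ge0// mulr_ge0// ltW.
  (* This step length makes [t * E] less than [D], which contradicts the
     first-order inequality, and [t * beta] less than [1]. *)
  pose t := D / (2 * (E + D)).
  have t0 : 0 < t by rewrite divr_gt0// mulr_gt0// ltr_wpDl.
  have tE : 2 * t * (E + D) = D by rewrite /t; field; rewrite gt_eqF// ltr_wpDl.
  have tb : t * beta < 1.
    rewrite -(ltr_pM2l D0) mulr1.
    have tF : 0 <= t * (p j * alpha + p i * beta).
      by apply: mulr_ge0 (ltW t0) (addr_ge0 (mulr_ge0 _ _) (mulr_ge0 _ _)).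
    have tD : 0 < t * D by rewrite mulr_gt0.
    have : t * (p j * alpha + p i * beta) + t * D + D * (t * beta) = D / 2.
      by rewrite -[in RHS]tE /E; field.
    by move=> *; lra.
  pose s k := if k == i then t / w i else if k == j then - (t / w j) else 0.
  have pos k : 0 < 1 + s k * a k.
    rewrite /s; case: eqP => [->|_].
      by rewrite ltr_pwDl// mulr_ge0// divr_ge0// ltW.
    case: eqP => [->|_]; last by rewrite mul0r addr0.
    by rewrite mulNr mulrAC -mulrA subr_gt0.
  pose T' k := T k + s k *: (x *m x^T).
  pose P' k := (B k)^T *m invmx (T' k) *m B k.
  have trP' k : \tr (P' k) =
      \tr ((B k)^T *m invmx (T k) *m B k) - s k / (1 + s k * a k) * p k.
    rewrite /P' /T' (proj2 (posdef_rank_one (pT k) (pos k))).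
    rewrite mulmxBr mulmxBl raddfB /= -scalemxAr -scalemxAl mxtraceZ.
    congr (_ - _ * _).
    have -> : p k = quadform (A k) (invmx (T k) *m x).
      by rewrite -quadform_congr sTV.
    rewrite /quadform -trace_mx11 AB; set y := invmx _ *m x.
    have -> : (B k)^T *m (y *m y^T) *m B k = ((B k)^T *m y) *m (y^T *m B k).
      by rewrite !mulmxA.
    by rewrite mxtrace_mulC !mulmxA.
  have swap (F : 'I_N -> R) : (forall k, s k = 0 -> F k = 0) ->
      \sum_k F k = F i + F j.
    move=> F0; rewrite (bigD1 i)//= (bigD1 j) 1?eq_sym//= big1 ?addr0//.
    by move=> k /andP[/negbTE ki /negbTE kj]; rewrite F0// /s ki kj.
  have si : s i = t / w i by rewrite /s eqxx.
  have sj : s j = - (t / w j) by rewrite /s eqxx eq_sym (negbTE ij).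
  have feas : dual_feasible w B T' P'.
    split=> [k|].
      apply: schur_possemidef; exact: (proj1 (posdef_rank_one (pT k) (pos k))).
    rewrite /T'; under eq_bigr do rewrite scalerDr scalerA.
    rewrite big_split /= sumT -scaler_suml (swap (fun k => w k * s k)) ?si ?sj.
      have -> : w i * (t / w i) + w j * - (t / w j) = 0.
        by field; rewrite !gt_eqF.
      by rewrite scale0r addr0.
    by move=> k ->; rewrite mulr0.
  have := minT _ _ feas; under [X in _ <= X]eq_bigr do rewrite trP' mulrBr.
  rewrite sumrB (swap (fun k => w k * (s k / (1 + s k * a k) * p k))); last first.
    by move=> k ->; rewrite mul0r mul0r mulr0.
  have := ler_sum (index_enum 'I_N) (P := xpredT)
    (fun k _ => ler_wpM2l (ltW (w0 k)) (schur_tr_le (pT k) (psd k))).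
  rewrite /= => /le_trans/[apply]; rewrite lerBrDl gerDr.
  have wi_neq0 : w i != 0 by rewrite gt_eqF.
  have wj_neq0 : w j != 0 by rewrite gt_eqF.
  have di0 : w i + t * a i != 0.
    by rewrite gt_eqF// ltr_pwDl// mulr_ge0// ltW.
  have dj0 : w j - t * a j != 0.
    rewrite gt_eqF// (_ : _ - _ = w j * (1 - t * beta)) ?mulr_gt0 ?subr_gt0//.
    by rewrite /beta; field.
  have -> : w i * (s i / (1 + s i * a i) * p i) = t * (p i / (1 + t * alpha)).
    by rewrite si /alpha; field; rewrite ?di0 ?wi_neq0.
  have -> : w j * (s j / (1 + s j * a j) * p j) = - (t * (p j / (1 - t * beta))).
    by rewrite sj /beta; field; rewrite ?dj0 ?wj_neq0.
  have ta : 0 < 1 + t * alpha by rewrite ltr_pwDl// mulr_ge0// ltW.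
  rewrite -mulrBr pmulr_rle0// subr_le0 ler_pdivrMr//.
  rewrite mulrAC ler_pdivlMr ?subr_gt0// => le_ij.
  have tDb : 0 <= t * (D * beta)
    by exact: mulr_ge0 (ltW t0) (mulr_ge0 (ltW D0) beta0).
  have tD : 0 < t * D by rewrite mulr_gt0.
  have tF : t * (p j * alpha) + t * (p i * beta) + t * (D * beta) + t * D = D / 2.
    by rewrite -[in RHS]tE /E; field.
  by rewrite /D in D0 tD tDb tF; clear -D0 tD tDb tF le_ij; lra.
pose i0 := Ordinal N0.
have eqX i : X i = X i0.
  have [->//|i_i0] := eqVneq i i0.
  apply/eqP; rewrite -subr_eq0; apply/eqP/quadform_eq0.
    by rewrite linearB /= (proj1 (pX i)) (proj1 (pX i0)).
  move=> v; rewrite quadformD quadformN; apply/eqP; rewrite subr_eq0 eq_le.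
  by rewrite !leX// eq_sym.
exists (X i0), T; split=> // i.
rewrite -(eqX i) /X !mulmxA mulmxV ?posdef_unitmx// mul1mx.
by rewrite -mulmxA mulVmx ?posdef_unitmx// mulmx1.
Qed.

(** * Square roots, transport certificates and the Bures-Wasserstein distance *)

(** For the two matrices [A], [1] and unit weights, [transport_maps_exist]
    gives [V + U = 2], [V X V = A] and [U X U = 1].  Hence [X = U^-2], the
    matrices [U] and [V = 2 - U] commute, and [(V U^-1)^2 = V X V = A].
    Positivity of [V U^-1] is that of [U V], since it is [U^-1 (U V) U^-1]; and
    [2 U V = V U V + U V U]. *)
Lemma posdef_sqrt_exists n (A : 'M[R]_n) :
  posdefmx A -> exists S, posdefmx S /\ S *m S = A.
Proof.
move=> pA; pose F (i : 'I_2) := if i == 0 then A else 1%:M.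
have [|X [T [_ pT sumT eqT]]] := 
  @transport_maps_exist n 2 (fun=> 1) F isT (fun=> ltr01).
  by move=> i; rewrite /F; case: ifP => _ //; exact: posdef1.
pose V := T 0; pose U := T 1.
have [pV pU] : posdefmx V /\ posdefmx U by split; exact: pT.
have uU := posdef_unitmx pU.
have VUV : V *m X *m V = A by rewrite eqT.
have UXU : U *m X *m U = 1%:M by rewrite eqT.
have VU2 : V + U = 2%:M.
  move: sumT; rewrite big_ord_recl big_ord1 !scale1r sumr_const card_ord => <-.
  by congr (_ + T _); apply/val_inj.
have VE : V = 2%:M - U by rewrite -VU2 addrK.
have comm : V *m U = U *m V by rewrite VE mulmxBl mulmxBr scalar_mxC.
have pUV : posdefmx (U *m V).
  have -> : U *m V = 2^-1 *: (V *m U *m V + U *m V *m U).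
    rewrite comm -mulmxDr VU2 mul_mx_scalar scalerA mulVf ?scale1r//.
    by rewrite pnatr_eq0.
  apply: posdefZ; first by rewrite invr_gt0.
  apply: posdefD.
    have := posdef_congr (posdef_unitmx pV) pU.
    by rewrite (proj1 pV).
  have := possemidef_congr U (posdef_possemidef pV).
  by rewrite (proj1 pU).
have XE : X = invmx U *m invmx U.
  rewrite -[X](mulKmx uU) -[U *m X](mulmxK uU) UXU.
  by rewrite mul1mx.
exists (invmx U *m (U *m V) *m invmx U); split.
  have := posdef_congr (_ : invmx U \in unitmx) pUV; rewrite unitmx_inv => /(_ uU).
  by rewrite trmx_inv (proj1 pU).
rewrite mulKmx// -[RHS]VUV XE.
have cV : V *m invmx U = invmx U *m V.
  by rewrite -[V in LHS](mulKmx uU) -comm -!mulmxA mulmxV// mulmx1.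
by rewrite {2}cV !mulmxA.
Qed.

Lemma sqrtmxP n (A : 'M[R]_n) :
  posdefmx A -> posdefmx (sqrtmx A) /\ sqrtmx A *m sqrtmx A = A.
Proof. by move=> /posdef_sqrt_exists/(xgetPex 0). Qed.

(** With [Q] the square root of [Y], the map is
    [Q^-1 (Q A Q)^(1/2) Q^-1]. *)
Lemma transport_map_exists n (A Y : 'M[R]_n) : posdefmx A -> posdefmx Y ->
  exists T, posdefmx T /\ T *m Y *m T = A.
Proof.
move=> pA /sqrtmxP[]; set Q := sqrtmx Y => pQ QQ.
have uQ := posdef_unitmx pQ.
have := posdef_congr uQ pA; rewrite (proj1 pQ) => /sqrtmxP[].
set H := sqrtmx _ => pH HH.
exists (invmx Q *m H *m invmx Q); split.
  have := posdef_congr (_ : invmx Q \in unitmx) pH; rewrite unitmx_inv => /(_ uQ).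
  by rewrite trmx_inv (proj1 pQ).
rewrite -QQ !mulmxA (mulmxKV uQ) (mulmxK uQ).
rewrite -[_ *m H *m H]mulmxA HH !mulmxA mulVmx// mul1mx.
by rewrite mulmxK.
Qed.

Lemma sdp_constraint_schur n (Y L : 'M[R]_n) :
  possemidefmx (block_mx Y L^T L 1%:M) -> possemidefmx (Y - L^T *m L).
Proof.
move=> /(possemidef_congr (col_mx 1%:M (- L))).
rewrite tr_col_mx mul_row_block mul_row_col trmx1 !mul1mx !mulmx1.
by rewrite [(- _)^T]linearN /= !mulNmx subrr mul0mx addr0.
Qed.

Lemma sdp_constraint_gram n (L : 'M[R]_n) :
  possemidefmx (block_mx (L^T *m L) L^T L 1%:M).
Proof.
have := possemidef_gram (row_mx L 1%:M).
by rewrite tr_row_mx mul_col_row trmx1 !mul1mx !mulmx1.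
Qed.

Lemma gram_eq0 m n (D : 'M[R]_(m, n)) : D^T *m D = 0 -> D = 0.
Proof.
move=> DD; apply/matrixP => i j; rewrite mxE; apply/eqP; rewrite -sqrf_eq0.
have /eqP := congr1 (fun M : 'M_n => M j j) DD; rewrite mxE mxE.
rewrite (eq_bigr (fun k => D k j ^+ 2)) => [|k _]; last by rewrite mxE expr2.
rewrite psumr_eq0 => [/allP/(_ i)|k _]; last exact: sqr_ge0.
by rewrite mem_index_enum; apply.
Qed.

(** Expanding the last square, [tr (T L^T L)] cancels, each of the two mixed
    terms is [tr (S L)], and the constant term is
    [tr (S S T^-1) = tr (T X)]. *)
Lemma transport_gap n (T S X L Y : 'M[R]_n) :
  posdefmx T -> S^T = S -> T *m X *m T = S *m S ->
  \tr (T *m X) + \tr (T *m Y) - 2 * \tr (S *m L) =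
  \tr (T *m (Y - L^T *m L)) +
  \tr (T *m ((L - S *m invmx T)^T *m (L - S *m invmx T))).
Proof.
move=> pT sS TXT; have uT := posdef_unitmx pT.
have sTV : (invmx T)^T = invmx T by rewrite trmx_inv (proj1 pT).
rewrite [(_ - _)^T]linearB /= trmx_mul sTV sS.
rewrite !mulmxBl !mulmxBr !raddfB /=.
have -> : \tr (T *m (L^T *m (S *m invmx T))) = \tr (S *m L).
  rewrite mxtrace_mulC -mulmxA mulmxKV//.
  by rewrite -mxtrace_tr trmx_mul trmxK sS.
have -> : \tr (T *m (invmx T *m S *m L)) = \tr (S *m L).
  by rewrite !mulmxA mulmxV// mul1mx.
have -> : \tr (T *m (invmx T *m S *m (S *m invmx T))) = \tr (T *m X).
  by rewrite !mulmxA mulmxV// mul1mx -TXT mulmxK.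
ring.
Qed.

Lemma transport_certificate n (T S X L Y : 'M[R]_n) :
  posdefmx T -> S^T = S -> T *m X *m T = S *m S ->
  possemidefmx (block_mx Y L^T L 1%:M) ->
  2 * \tr (S *m L) <= \tr (T *m X) + \tr (T *m Y).
Proof.
move=> pT sS TXT /sdp_constraint_schur pY.
rewrite -subr_ge0 (transport_gap _ _ pT sS TXT) addr_ge0// posdef_tr_mul_ge0//.
exact: possemidef_gram.
Qed.

(** Both summands of [transport_gap] vanish.  As [T] is definite,
    [L = S T^-1], so that [L^T L = T^-1 S S T^-1 = X], and [Y = L^T L]. *)
Lemma transport_certificate_eq n (T S X L Y : 'M[R]_n) :
  posdefmx T -> S^T = S -> T *m X *m T = S *m S ->
  possemidefmx (block_mx Y L^T L 1%:M) ->
  2 * \tr (S *m L) = \tr (T *m X) + \tr (T *m Y) ->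
  Y = X /\ L^T *m L = X.
Proof.
move=> pT sS TXT /sdp_constraint_schur pY /esym/eqP.
rewrite -subr_eq0 (transport_gap _ _ pT sS TXT).
have pD := possemidef_gram (L - S *m invmx T).
rewrite paddr_eq0 ?posdef_tr_mul_ge0// => /andP[/eqP tY /eqP tD].
have uT := posdef_unitmx pT.
have LE : L = S *m invmx T.
  by apply/eqP; rewrite -subr_eq0; apply/eqP/gram_eq0/(posdef_tr_mul_eq0 pT pD tD).
have LX : L^T *m L = X.
  rewrite LE trmx_mul trmx_inv (proj1 pT) sS -mulmxA [S *m _]mulmxA -TXT.
  by rewrite mulmxK// mulKmx.
by move: (posdef_tr_mul_eq0 pT pY tY); rewrite LX => /subr0_eq.
Qed.

Lemma frobnorm_sq m n (M : 'M[R]_(m, n)) : frobnorm M ^+ 2 = \tr (M^T *m M).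
Proof.
rewrite /frobnorm sqr_sqrtr; last first.
  by apply: sumr_ge0 => i _; apply: sumr_ge0 => j _; exact: sqr_ge0.
rewrite exchange_big; apply: eq_bigr => j _; rewrite mxE.
by apply: eq_bigr => i _; rewrite mxE expr2.
Qed.

(** For orthogonal [U], [V] the squared distance is
    [tr A + tr Y - 2 tr (S L)] with [L = U V^T Q], where [S] and [Q] are the
    square roots of [A] and [Y]; as [L^T L = Y], the certificate bounds
    [tr (S L)] by [tr (T Y)].  The bound is attained for [L = S T^-1], that is
    for [V = 1] and [U = S T^-1 Q^-1]. *)
Lemma bures_wassersteinE n (A Y T : 'M[R]_n) :
  posdefmx A -> posdefmx Y -> posdefmx T -> T *m Y *m T = A ->
  bures_wasserstein A Y ^+ 2 = \tr A + \tr Y - 2 * \tr (T *m Y).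
Proof.
move=> pA pY pT TYT.
have [] := sqrtmxP pA; have [] := sqrtmxP pY; rewrite /bures_wasserstein.
set Q := sqrtmx Y; set S := sqrtmx A => pQ QQ pS SS.
have [sQ sS] := (proj1 pQ, proj1 pS).
have dist (U V : 'M[R]_n) : U^T *m U = 1%:M -> V^T *m V = 1%:M ->
    frobnorm (S *m U - Q *m V) ^+ 2 =
    \tr A + \tr Y - 2 * \tr (S *m (U *m V^T *m Q)).
  move=> UU VV; rewrite frobnorm_sq [(_ - _)^T]linearB /= !trmx_mul sS sQ.
  rewrite mulmxBl !mulmxBr !raddfB /=.
  have -> : \tr (U^T *m S *m (S *m U)) = \tr A.
    by rewrite mxtrace_mulC !mulmxA -[_ *m U *m _]mulmxA (mulmx1C UU) mulmx1 SS.
  have -> : \tr (V^T *m Q *m (Q *m V)) = \tr Y.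
    by rewrite mxtrace_mulC !mulmxA -[_ *m V *m _]mulmxA (mulmx1C VV) mulmx1 QQ.
  have -> : \tr (U^T *m S *m (Q *m V)) = \tr (S *m (U *m V^T *m Q)).
    rewrite -mxtrace_tr !trmx_mul trmxK sS sQ mxtrace_mulC.
    by rewrite !mulmxA.
  have -> : \tr (V^T *m Q *m (S *m U)) = \tr (S *m (U *m V^T *m Q)).
    by rewrite mxtrace_mulC !mulmxA.
  ring.
set E := (X in inf X).
have lbE e : E e -> \tr A + \tr Y - 2 * \tr (T *m Y) <= e ^+ 2.
  move=> [U UU [V VV <-]]; rewrite dist// lerB//.
  have LL : (U *m V^T *m Q)^T *m (U *m V^T *m Q) = Y.
    rewrite !trmx_mul trmxK sQ !mulmxA -[_ *m U^T *m U]mulmxA UU mulmx1.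
    by rewrite -[_ *m V *m _]mulmxA (mulmx1C VV) mulmx1.
  have := sdp_constraint_gram (U *m V^T *m Q); rewrite LL => pZ.
  have /le_trans := transport_certificate pT sS (etrans TYT (esym SS)) pZ; apply.
  by rewrite mulr2n mulrDl !mul1r.
pose U := S *m invmx T *m invmx Q.
have uT := posdef_unitmx pT; have uQ := posdef_unitmx pQ.
have UU : U^T *m U = 1%:M.
  rewrite /U !trmx_mul !trmx_inv (proj1 pT) sS sQ.
  have -> : invmx Q *m (invmx T *m S) *m (S *m invmx T *m invmx Q) =
      invmx Q *m (invmx T *m (S *m S) *m invmx T) *m invmx Q.
    by rewrite !mulmxA.
  by rewrite SS -TYT -!mulmxA mulKmx// mulKVmx// -QQ mulmxK// mulVmx.
pose e0 := frobnorm (S *m U - Q *m 1%:M).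
have Ee0 : E e0.
  by exists U => //; exists 1%:M => //; rewrite /orthogonal_group /= trmx1 mul1mx.
have e0E : e0 ^+ 2 = \tr A + \tr Y - 2 * \tr (T *m Y).
  rewrite dist ?trmx1 ?mul1mx// mulmx1 /U mulmxKV// mulmxA SS -TYT.
  by rewrite mulmxK.
have nnegE e : E e -> 0 <= e by move=> [V _ [W _ <-]]; exact: sqrtr_ge0.
suff -> : inf E = e0 by [].
apply/eqP; rewrite eq_le; apply/andP; split.
  by apply: ge_inf => //; exists 0 => e /nnegE.
apply: lb_le_inf; first by exists e0.
move=> e Ee; rewrite -(@ler_pXn2r _ 2) ?nnegrE ?nnegE// e0E; exact: lbE.
Qed.

End BuresWassersteinBarycenter.

(** * Optimality of the semidefinite program and of the barycenter *)

Theorem mainTheorem2 (R : realType) (n N : nat) (w : 'I_N -> R)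
    (A : 'I_N -> 'M[R]_n)
    (hN : (0 < N)%N)
    (hw : forall i : 'I_N, 0 < w i)
    (hA : forall i : 'I_N, posdefmx (A i)) :
  (exists (X : 'M[R]_n) (K : 'I_N -> 'M[R]_n), sdp_optimum w A X K) /\
  (forall (X : 'M[R]_n) (K : 'I_N -> 'M[R]_n), sdp_optimum w A X K ->
     (forall i : 'I_N, (K i)^T *m K i = X) /\
     (forall Y : 'M[R]_n, is_barycenter w A Y <-> Y = X)).
Proof.
have [X [T [pX pT sumT eqT]]] := transport_maps_exist hN hw hA.
pose S i := sqrtmx (A i).
have [pS SS] : (forall i, posdefmx (S i)) /\ (forall i, S i *m S i = A i).
  by split=> i; have [] := sqrtmxP (hA i).
have eqTS i : T i *m X *m T i = S i *m S i by rewrite SS.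
have sS i : (S i)^T = S i := proj1 (pS i).
(* The common value of the two problems; by [sum_trT] it is the sum of the
   [w i * \tr (A i)] minus [\sum_i w i * \tr X]. *)
pose opt := \sum_i w i * (\tr (A i) - \tr (T i *m X)).
have sum_trT (Y : 'M_n) : \sum_i w i * \tr (T i *m Y) = \sum_i w i * \tr Y.
  rewrite -mulr_suml -mxtraceZ -mul_scalar_mx -sumT mulmx_suml raddf_sum /=.
  by apply: eq_bigr => i _; rewrite -scalemxAl mxtraceZ.
have costE Y L : sdp_cost w A Y L = opt +
    \sum_i w i * (\tr (T i *m X) + \tr (T i *m Y) - 2 * \tr (S i *m L i)).
  rewrite /opt -big_split /=; apply/eqP; rewrite -subr_eq0 -sumrB.
  rewrite (eq_bigr (fun i => w i * \tr Y - w i * \tr (T i *m Y))).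
    by rewrite sumrB sum_trT subrr.
  by move=> i _; rewrite /S; ring.
have gap_ge0 Y L : sdp_feasible Y L -> forall i,
    0 <= w i * (\tr (T i *m X) + \tr (T i *m Y) - 2 * \tr (S i *m L i)).
  move=> [_ fL] i; apply: mulr_ge0; first exact/ltW.
  by rewrite subr_ge0; exact: transport_certificate.
have lower Y L : sdp_feasible Y L -> opt <= sdp_cost w A Y L.
  by move=> f; rewrite costE lerDl sumr_ge0// => i _; exact: gap_ge0.
(* A feasible point of minimal cost has no gap at any index. *)
have unique Y L : sdp_feasible Y L -> sdp_cost w A Y L <= opt ->
    Y = X /\ forall i, (L i)^T *m L i = X.
  move=> f le_opt.
  have tight i : Y = X /\ (L i)^T *m L i = X.
    move: le_opt; rewrite costE gerDl => le0.
    have ge0 := sumr_ge0 _ (P := xpredT) (fun i _ => gap_ge0 _ _ f i).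
    have /eqP := le_anti (introT andP (conj le0 (ge0 _))).
    rewrite psumr_eq0 => [/allP/(_ i)|k _]; last exact: gap_ge0.
    rewrite mem_index_enum mulf_eq0 gt_eqF//= subr_eq0 => /(_ isT)/eqP eqL.
    by apply: transport_certificate_eq (sS i) (eqTS i) (proj2 f i) (esym eqL).
  by split=> [|i]; [have [] := tight (Ordinal hN) | have [] := tight i].
(* The barycenter cost at [Y] is the cost of a feasible point over [Y]. *)
have reach Y : posdefmx Y ->
    exists2 L, sdp_feasible Y L & sdp_cost w A Y L = bary_cost w A Y.
  move=> pY.
  have [TY TYP] := choice (fun i => transport_map_exists (hA i) pY).
  exists (fun i => S i *m invmx (TY i)).
    split=> // i; have [pTi TYT] := TYP i; have uTi := posdef_unitmx pTi.
    have {1}-> : Y = (S i *m invmx (TY i))^T *m (S i *m invmx (TY i)).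
      rewrite trmx_mul trmx_inv (proj1 pTi) sS -mulmxA [S i *m _]mulmxA SS -TYT.
      by rewrite mulmxK// mulKmx.
    exact: sdp_constraint_gram.
  apply: eq_bigr => i _; have [pTi TYT] := TYP i; have uTi := posdef_unitmx pTi.
  rewrite (bures_wassersteinE (hA i) pY pTi TYT) -/(S i) mulmxA SS -{2}TYT.
  by rewrite mulmxK.
have [K fK costK] := reach X pX.
have costX : bary_cost w A X = opt.
  rewrite /bary_cost /opt.
  rewrite (eq_bigr (fun i => w i * (\tr (A i) - \tr (T i *m X)) +
    (w i * \tr X - w i * \tr (T i *m X)))).
    by rewrite big_split sumrB /= sum_trT subrr addr0.
  by move=> i _; rewrite (bures_wassersteinE (hA i) pX (pT i) (eqT i)); ring.
split.
  exists X, K; split=> // Y L fL; rewrite costK costX; exact: lower.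
move=> X' K' [f' opt'].
have [->{X' opt' f'} KK] : X' = X /\ forall i, (K' i)^T *m K' i = X.
  by apply: unique => //; rewrite -costX -costK; exact: opt'.
split=> [//|Y]; split=> [[pY minY]|->].
  have [L fL costL] := reach Y pY.
  have [] := unique Y L fL => //.
  by rewrite costL -costX; exact: minY.
split=> [//|Y' /reach[L fL <-]]; rewrite costX; exact: lower.
Qed.
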